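(* Let $(\mathcal X,\rho)$ be a complete separable metric space, let $f_1,\dots,f_m:\mathcal X\to\mathcal X$ be Lipschitz maps, and let $(\mu_k)_{k\ge0}$ be probability measures on $\{1,\dots,m\}$ such that, for a constant $e\ge 0$, $\sum_{j=1}^m|\mu_k(j)-\mu_{k+1}(j)|\le e$ for all $k>0$. Let $\alpha\in(0,1]$ and let $r\in(0,1)$ be such that $d(P_k^*\nu_1,P_k^*\nu_2)\le r\,d(\nu_1,\nu_2)$ for all $k$ and all Borel probability measures $\nu_1,\nu_2$ on $\mathcal X$. For each $k$ let $\nu_k^*$ be a Borel probability measure on $\mathcal X$ with $P_k^*\nu_k^*=\nu_k^*$, let $\nu_k^0$ be the Borel probability measure on $\mathcal X$ describing the state when $\mu_k$ becomes active, and let $\nu_k^i=P_k^*\nu_k^{i-1}$ for $i\ge1$. Then for all $k$, $$d(\nu_k^1,\nu_k^* )\le\left[\frac{r}{(1-r)^2}\right]d(\nu_k^1,\nu_k^0).$$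
   Context: $P_k^*$ acts on Borel probability measures by $(P_k^*\nu)(A)=\sum_{j=1}^m\mu_k(j)\,\nu(f_j^{-1}(A))$ for Borel sets $A$. With $\mathcal F_\alpha=\{f:\mathcal X\to\mathbb R:\ |f(x)-f(y)|\le\rho(x,y)^\alpha\ \text{for all }x,y\}$, the Wasserstein-type metric is $d(\nu_1,\nu_2)=\sup_{f\in\mathcal F_\alpha}\left[\int f\,d\nu_1-\int f\,d\nu_2\right]$, where the supremum is over those $f\in\mathcal F_\alpha$ integrable with respect to both measures, with values in $[0,\infty]$. No restriction is placed on the measures $\nu_k^0$. *)

(* Defs.v *)
From HB Require Import structures.
From mathcomp Require Import all_boot all_order all_algebra.
From mathcomp Require Import all_classical all_reals all_analysis.

Set Implicit Arguments.
Unset Strict Implicit.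
Unset Printing Implicit Defensive.

Import Order.TTheory GRing.Theory Num.Theory.
Import numFieldNormedType.Exports.

Local Open Scope classical_set_scope.
Local Open Scope ring_scope.

(* [Complete] bundles a base point; a space carrying a probability measure is
   nonempty, so this excludes no case of interest. *)
#[short(type="completeMetricType")]
HB.structure Definition CompleteMetric (R : numDomainType) :=
  {T of Metric R T & Complete T}.

Definition separable (T : topologicalType) : Prop :=
  exists2 D : set T, countable D & dense D.

(* [X] equipped with its Borel sigma-algebra. *)
Notation borel X := (g_sigma_algebraType (@open X)).

Definition lipschitz_map (R : realType) (X Y : metricType R) (f : X -> Y) :
  Prop := exists L : R, forall x y : X, mdist (f x) (f y) <= L * mdist x y.

(* Probability measures on the finite set {1, ..., m}, indexed here by ['I_m],
   are given by their point masses. *)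
Definition probability_weights (R : realType) (m : nat) (w : 'I_m -> R) :
  Prop := (forall j, 0 <= w j) /\ \sum_(j < m) w j = 1.

Section transfer_and_distance.
Context {R : realType} {X : completeMetricType R}.
Implicit Types nu : set (borel X) -> \bar R.

(* Defined on set functions, so that no proof that the [f j] are Borel is
   needed to form it; the value on a set which is not Borel is irrelevant. *)
Definition Pstar (m : nat) (f : 'I_m -> X -> X) (w : 'I_m -> R) nu :
    set (borel X) -> \bar R :=
  fun A => (\sum_(j < m) (w j)%:E * nu (f j @^-1` A))%E.

Definition holder_class (alpha : R) : set (X -> R) :=
  [set g | forall x y : X, `|g x - g y| <= mdist x y `^ alpha].

Definition wasserstein (alpha : R) nu1 nu2 : \bar R :=
  ereal_sup [set (\int[nu1]_x (g x)%:E - \int[nu2]_x (g x)%:E)%E | g in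
    [set g : borel X -> R | [/\ holder_class alpha g,
       nu1.-integrable setT (EFin \o g) & nu2.-integrable setT (EFin \o g)]]].

End transfer_and_distance.

(* Main.v *)
Require Import Defs.
From HB Require Import structures.
From mathcomp Require Import all_boot all_order all_algebra.
From mathcomp Require Import all_classical all_reals all_analysis.
From mathcomp Require Import measurable_realfun ring lra.

Set Implicit Arguments.
Unset Strict Implicit.
Unset Printing Implicit Defensive.

Import Order.TTheory GRing.Theory Num.Theory.
Import numFieldNormedType.Exports.

Local Open Scope classical_set_scope.
Local Open Scope ring_scope.

(** Fix one kernel. Integrating against [Pstar nu] is the same as integrating
    the averaged function [T h x = \sum_j w j * h (f j x)] against [nu]
    ([integral_Pstar]). The distance between the Dirac masses at [x] and [y] is at
    most [mdist x y `^ alpha], so the contraction hypothesis, applied to Dirac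
    masses, says that [T] shrinks the Hoelder constant of a bounded function by
    the factor [r] ([transfer_scaled_holder]).

    Let [g] be bounded with Hoelder constant 1, let [h n] be the [n]-th iterate
    [T (... (T g))], whose Hoelder constant is [r ^ n], and write [E0], [E1], [E*]
    for the integrals against the initial law, its image and the invariant law.
    Then [E* (h n)] does not depend on [n] and [E1 (h n) = E0 (h n.+1)], so
      [E1 g - E* g = \sum_(i < n) (E0 (h i.+1) - E1 (h i.+1)) + (E1 (h n) - E* (h n))].
    The [i]-th term of the sum is at most [r ^ i.+1] times the distance [D] from
    the image to the initial law ([scaled_holder_gap]), and the remainder tends
    to 0 because [h n] flattens out pointwise while staying bounded
    ([Rintegral_flattening]). Summing the geometric series gives the bound
    [r / (1 - r) * D] ([wasserstein_invariant_le]), and [1 - r <= 1] finishes.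

    Flattening is what makes the argument work without any moment assumption:
    it is not known beforehand that the initial law is at finite distance from
    the invariant one, so the inequality
    [d(nu1, nu* ) <= r * d(nu0, nu* ) <= r * (d(nu0, nu1) + d(nu1, nu* ))]
    could not be solved for [d(nu1, nu* )]. Bounded test functions suffice since
    truncation preserves the Hoelder condition ([wasserstein_le_between]), and
    they spare the discussion of integrability against the intermediate laws. *)

Local Notation mean nu h := (Rintegral nu setT (h : borel _ -> _)).

(** * Measurability of Hoelder functions and Lipschitz maps *)

Section measurability.
Context {R : realType} {X : completeMetricType R}.

Lemma continuous_borel_measurable_fun (g : X -> R) :
  continuous g -> measurable_fun [set: borel X] (g : borel X -> R).
Proof.
move=> /continuousP cg.
apply: (measurability _ (RGenOpens.measurableE R)).
move=> _ [_ [a [b ->]] <-]; rewrite setTI.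
by apply: sub_sigma_algebra; apply: cg; exact: interval_open.
Qed.

Lemma continuous_borel_measurable_map (f : X -> X) :
  continuous f -> measurable_fun [set: borel X] (f : borel X -> borel X).
Proof.
move=> /continuousP cf.
apply: (@measurability _ _ (borel X) (borel X) setT f (@open X)) => //.
by move=> _ [U oU <-]; rewrite setTI; apply: sub_sigma_algebra; exact: cf.
Qed.

Definition scaled_holder (alpha c : R) (h : X -> R) :=
  forall x y, `|h x - h y| <= c * mdist x y `^ alpha.

Lemma holder_class_scaled alpha (g : X -> R) :
  holder_class alpha g -> scaled_holder alpha 1 g.
Proof. by move=> gH x y; rewrite mul1r; exact: gH. Qed.

Lemma scaled_holder_measurable alpha c (h : X -> R) : 0 < alpha ->
  scaled_holder alpha c h -> measurable_fun [set: borel X] (h : borel X -> R).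
Proof.
move=> a0 hH; apply: continuous_borel_measurable_fun => x.
apply/cvgrPdist_lt => e e0.
have c0 : 0 < `|c| + 1 by rewrite ltr_wpDl.
pose d := (e / (`|c| + 1)) `^ alpha^-1.
have d0 : 0 < d by rewrite powR_gt0// divr_gt0.
near=> y.
apply: (le_lt_trans (hH x y)).
have xy : mdist x y < d.
  have : ball x d y by near: y; exact: nbhsx_ballx.
  by rewrite ballEmdist.
have : mdist x y `^ alpha < e / (`|c| + 1).
  have -> : e / (`|c| + 1) = d `^ alpha.
    by rewrite -powRrM mulVf ?gt_eqF// powRr1// ltW// divr_gt0.
  by rewrite gt0_ltr_powR ?nnegrE ?mdist_ge0// ltW.
rewrite ltr_pdivlMr// mulrC; apply: le_lt_trans.
by rewrite ler_wpM2r ?powR_ge0// (le_trans (ler_norm c))// lerDl.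
Unshelve. all: by end_near. Qed.

Lemma lipschitz_map_measurable (f : X -> X) :
  lipschitz_map f -> measurable_fun [set: borel X] (f : borel X -> borel X).
Proof.
move=> [L fL]; apply: continuous_borel_measurable_map => x.
apply/cvg_ballP => e e0.
have c0 : 0 < `|L| + 1 by rewrite ltr_wpDl.
have d0 : 0 < e / (`|L| + 1) by rewrite divr_gt0.
near=> y; rewrite ballEmdist/=; apply: (le_lt_trans (fL x y)).
have : mdist x y < e / (`|L| + 1).
  have : ball x (e / (`|L| + 1)) y by near: y; exact: nbhsx_ballx.
  by rewrite ballEmdist.
rewrite ltr_pdivlMr// mulrC; apply: le_lt_trans.
by rewrite ler_wpM2r ?mdist_ge0// (le_trans (ler_norm L))// lerDl.
Unshelve. all: by end_near. Qed.

End measurability.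

(** * Bounded test functions *)

(** Bounded test functions are taken nonnegative so that the integration lemmas
    for nonnegative functions, which ask for no integrability, apply to them;
    adding a constant changes no difference of integrals of probabilities. *)
Definition between {R : realType} {X : Type} (M : R) (h : X -> R) :=
  forall x, 0 <= h x <= M.

Lemma between_integrable d (T : measurableType d) (R : realType)
    (nu : {finite_measure set T -> \bar R}) (M : R) (h : T -> R) :
  measurable_fun setT h -> between M h -> nu.-integrable setT (EFin \o h).
Proof.
move=> mh hM; apply: (@le_integrable _ _ _ _ _ measurableT _ (EFin \o cst M)).
- exact/measurable_EFinP.
- move=> x _ /=; have /andP[h0 h1] := hM x.
  by rewrite lee_fin !ger0_norm// (le_trans h0).
- exact: finite_measure_integrable_cst.
Qed.

Lemma Rintegral_probability_cst d (T : measurableType d) (R : realType)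
    (nu : probability T R) (c : R) : Rintegral nu setT (cst c) = c.
Proof. by rewrite Rintegral_cst// [X in fine X]probability_setT mulr1. Qed.

Lemma cvg_Rintegral_dominated d (T : measurableType d) (R : realType)
    (nu : {measure set T -> \bar R}) (u : nat -> T -> R) (v G : T -> R) :
  (forall n, measurable_fun setT (u n)) -> measurable_fun setT v ->
  (forall x, u n x @[n --> \oo] --> v x) ->
  (forall n x, `|u n x| <= G x) ->
  nu.-integrable setT (EFin \o G) ->
  Rintegral nu setT (u n) @[n --> \oo] --> Rintegral nu setT v.
Proof.
move=> mu mv uv uG iG.
have [| | | | | iv _ cv] := @dominated_convergence _ _ _ nu setT measurableT
  (fun n => EFin \o u n) (EFin \o v) (EFin \o G).
- by move=> n; exact/measurable_EFinP.
- exact/measurable_EFinP.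
- by apply: aeW => x _; apply: cvg_EFin (uv x); exact: nearW.
- exact: iG.
- by apply: aeW => x n _; rewrite lee_fin.
apply: fine_cvg; rewrite fineK//; exact: integrable_fin_num.
Qed.

Lemma dist_max_le (R : realDomainType) (c a b : R) :
  `|Num.max c a - Num.max c b| <= `|a - b|.
Proof.
by case: (lerP c a) => ?; case: (lerP c b) => ?; case: (ger0P (a - b)) => ?;
  rewrite ?ler_norml; first [lra | apply/andP; split; lra].
Qed.

Lemma dist_min_le (R : realDomainType) (c a b : R) :
  `|Num.min a c - Num.min b c| <= `|a - b|.
Proof.
by case: (lerP a c) => ?; case: (lerP b c) => ?; case: (ger0P (a - b)) => ?;
  rewrite ?ler_norml; first [lra | apply/andP; split; lra].
Qed.

Section wasserstein_lemmas.
Context {R : realType} {X : completeMetricType R}.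
Implicit Types nu : probability (borel X) R.

Lemma wasserstein_ge0 alpha nu1 nu2 : (0 <= wasserstein alpha nu1 nu2)%E.
Proof.
apply: ereal_sup_ubound; exists (cst 0).
  split; first by move=> x y; rewrite subrr normr0 powR_ge0.
  - exact: (finite_measure_integrable_cst _ 0).
  - exact: (finite_measure_integrable_cst _ 0).
by rewrite !integral0 sube0.
Qed.

(** The truncations of a Hoelder function at levels [- n] and [n] are again
    Hoelder with the same constant, and their integrals converge to that of the
    function by dominated convergence. *)
Lemma wasserstein_le_between alpha nu1 nu2 (C : R) : 0 < alpha ->
  (forall (g : X -> R) M, holder_class alpha g -> between M g ->
    mean nu1 g - mean nu2 g <= C) ->
  (wasserstein alpha nu1 nu2 <= C%:E)%E.
Proof.
move=> a0 H; apply: ge_ereal_sup => _ [g [gH ig1 ig2] <-].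
rewrite -[X in (X - _)%E]fineK ?integrable_fin_num//.
rewrite -[X in (_ - X)%E]fineK ?integrable_fin_num//.
rewrite -EFinB lee_fin.
have mH (h : X -> R) : holder_class alpha h -> measurable_fun [set: borel X] h.
  by move=> /holder_class_scaled; exact: scaled_holder_measurable.
pose t (n : nat) x : R := Num.max (- n%:R) (Num.min (g x) n%:R).
have tH n : holder_class alpha (t n).
  move=> x y; apply: le_trans (gH x y); rewrite /t.
  exact: (le_trans (dist_max_le _ _ _) (dist_min_le _ _ _)).
have tb n x : - n%:R <= t n x <= n%:R.
  have n0 : 0 <= n%:R :> R by [].
  by rewrite /t le_max lexx ge_max ge_min lexx orbT andbT/=; lra.
(* truncation fixes 0, and so, being 1-Lipschitz, does not increase norms *)
have tg n x : `|t n x| <= `|g x|.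
  have n0 : 0 <= n%:R :> R by [].
  have := dist_max_le (- n%:R) (Num.min (g x) n%:R) (Num.min 0 n%:R).
  have n0' : - n%:R <= 0 :> R by rewrite oppr_le0.
  rewrite (min_l n0) (max_r n0') !subr0 -/(t n x) => /le_trans; apply.
  by have := dist_min_le n%:R (g x) 0; rewrite (min_l n0) !subr0.
have tcvg x : t n x @[n --> \oo] --> g x.
  apply: cvg_near_cst; near=> n.
  have : `|g x| <= n%:R by near: n; exact: nbhs_infty_ger.
  by rewrite ler_norml => /andP[h1 h2]; rewrite /t min_l// max_r.
have icvg nu : nu.-integrable setT (EFin \o g) ->
    mean nu (t n) @[n --> \oo] --> mean nu g.
  move=> ig; apply: (@cvg_Rintegral_dominated _ _ _ _ _ _ (fun x => `|g x|)) => //.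
  - by move=> n; exact: mH.
  - exact: mH.
  - exact: integrable_norm.
apply: (cvgr_to_le (cvgB (icvg _ ig1) (icvg _ ig2))); apply: nearW => n.
have tM : between (n%:R + n%:R) (fun x => t n x + n%:R).
  by move=> x; have := tb n x; lra.
have := H _ _ _ tM.
have it nu : nu.-integrable setT (EFin \o (t n : borel X -> R)).
  apply: (@le_integrable _ _ _ _ _ measurableT _ (EFin \o cst n%:R)).
  - by apply/measurable_EFinP; exact: mH.
  - by move=> x _ /=; rewrite lee_fin [leRHS]ger0_norm// ler_norml.
  - exact: finite_measure_integrable_cst.
have shift nu : mean nu (fun x : borel X => t n x + n%:R) = mean nu (t n) + n%:R.
  rewrite RintegralD//; [|exact: it|exact: finite_measure_integrable_cst].
  by rewrite Rintegral_probability_cst.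
rewrite !shift opprD addrACA subrr addr0; apply.
by move=> x y; rewrite opprD addrACA subrr addr0; exact: tH.
Unshelve. all: by end_near. Qed.

(** The test function is [- h / c]: its sign accounts for the exchange of [nu1]
    and [nu2] between hypothesis and conclusion. *)
Lemma scaled_holder_gap alpha c D M nu1 nu2 (h : X -> R) :
  0 < alpha -> 0 < c -> between M h -> scaled_holder alpha c h ->
  (wasserstein alpha nu1 nu2 <= D%:E)%E ->
  mean nu2 h - mean nu1 h <= c * D.
Proof.
move=> a0 c0 hM hH wD.
have mh := scaled_holder_measurable a0 hH.
have ih nu : nu.-integrable setT (EFin \o (h : borel X -> R)).
  exact: between_integrable mh hM.
pose g : borel X -> R := fun x => - c^-1 * h x.
have ig nu : nu.-integrable setT (EFin \o g).
  have := integrableZl measurableT (- c^-1) (ih nu).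
  by congr (integrable _ _ _); apply/funext => x; rewrite /= EFinM.
rewrite -ler_pdivrMl// -lee_fin; apply: le_trans wD.
apply: ereal_sup_ubound; exists g.
  split => // x y.
  rewrite /g -mulrBr normrM normrN (gtr0_norm (_ : 0 < c^-1)) ?invr_gt0//.
  by rewrite ler_pdivrMl.
rewrite -[X in (X - _)%E]fineK ?(integrable_fin_num measurableT (ig _))//.
rewrite -[X in (_ - X)%E]fineK ?(integrable_fin_num measurableT (ig _))//.
rewrite -EFinB -![fine _]/(Rintegral _ _ _) /g !RintegralZl//.
- by rewrite !mulNr opprK mulrBr addrC.
- exact: ih.
- exact: ih.
Qed.

(** As the Hoelder constants tend to 0, [h n] becomes constant in the limit, so
    its mean under any law is asymptotic to its value at any given point. *)
Lemma Rintegral_flattening alpha r M nu (h : nat -> X -> R) (x0 : X) :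
  0 < alpha -> 0 < r -> r < 1 ->
  (forall n, between M (h n)) -> (forall n, scaled_holder alpha (r ^+ n) (h n)) ->
  mean nu (h n) - h n x0 @[n --> \oo] --> 0.
Proof.
move=> a0 r0 r1 hM hH.
have mh n := scaled_holder_measurable a0 (hH n).
rewrite (_ : (fun n => _) =
    (fun n => mean nu (fun x : borel X => h n x - h n x0))); last first.
  apply/funext => n; rewrite RintegralB ?Rintegral_probability_cst//.
  - exact: between_integrable (mh n) (hM n).
  - exact: finite_measure_integrable_cst.
rewrite -[X in _ --> X](Rintegral_probability_cst nu).
apply: (@cvg_Rintegral_dominated _ _ _ _ _ _ (cst M)) => //.
- by move=> n; exact: measurable_funB.
- move=> x; apply/norm_cvg0P.
  apply: (@squeeze_cvgr _ _ _ _ (cst 0) (fun n => r ^+ n * mdist x x0 `^ alpha)).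
  + by apply: nearW => n; rewrite normr_ge0/=; exact: hH.
  + exact: cvg_cst.
  + rewrite -[X in _ --> X](mul0r (mdist x x0 `^ alpha)).
    by apply: cvgMr_tmp; apply: cvg_expr; rewrite gtr0_norm.
- move=> n x; have := hM n x; have := hM n x0.
  by rewrite ler_norml /=; lra.
- exact: finite_measure_integrable_cst.
Qed.

Lemma wasserstein_dirac_le alpha (x y : X) : 0 < alpha ->
  (wasserstein alpha \d_(x : borel X) \d_(y : borel X)
     <= (mdist x y `^ alpha)%:E)%E.
Proof.
move=> a0; apply: ge_ereal_sup => _ [g [gH _ _] <-].
have mg := scaled_holder_measurable a0 (holder_class_scaled gH).
rewrite !integral_dirac//; try exact/measurable_EFinP.
rewrite !diracT !mul1e -EFinB lee_fin.
exact: le_trans (ler_norm _) (gH x y).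
Qed.

End wasserstein_lemmas.

(** * The transfer operator on functions *)

Definition transfer {R : realType} {X : Type} (m : nat) (f : 'I_m -> X -> X)
  (w : 'I_m -> R) (h : X -> R) (x : X) : R := \sum_(j < m) w j * h (f j x).

Section transfer.
Context {R : realType} {X : completeMetricType R}.
Context (m : nat) (f : 'I_m -> X -> X) (w : 'I_m -> R).
Context (f_lip : forall j, lipschitz_map (f j)) (w_prob : probability_weights w).
Implicit Types nu : probability (borel X) R.

Lemma transfer_between M (h : X -> R) : between M h -> between M (transfer f w h).
Proof.
case: w_prob => w0 w1 hM x; rewrite /transfer; apply/andP; split.
  by apply: sumr_ge0 => j _; rewrite mulr_ge0//; have /andP[] := hM (f j x).
rewrite -[leRHS]mul1r -w1 mulr_suml; apply: ler_sum => j _.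
by rewrite ler_wpM2l//; have /andP[] := hM (f j x).
Qed.

Lemma transfer_measurable (h : X -> R) :
  measurable_fun [set: borel X] (h : borel X -> R) ->
  measurable_fun [set: borel X] (transfer f w h : borel X -> R).
Proof.
move=> mh; apply: measurable_sum => j; apply: measurable_funM => //.
exact: (measurableT_comp mh (lipschitz_map_measurable (f_lip j))).
Qed.

(** [Pstar f w nu] is the sum of the images of [nu] under the [f j], scaled by
    the weights. The measure [p] is exposed so that a law which agrees with
    [Pstar f w nu] on Borel sets only can be compared with it. *)
Lemma Pstar_measure nu :
  exists2 p : {measure set (borel X) -> \bar R}, Pstar f w nu = p &
    forall h : borel X -> R, measurable_fun setT h -> (forall x, 0 <= h x) ->
    (\int[p]_x (h x)%:E = \int[nu]_x (transfer f w h x)%:E)%E.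
Proof.
case: m f w f_lip w_prob => [|n] f' w' f'_lip [w0 w1].
  by move: w1; rewrite big_ord0 => /eqP; rewrite eq_sym oner_eq0.
have mf j := lipschitz_map_measurable (f'_lip j).
pose F j : {mfun borel X >-> borel X} := HB.pack (f' j : borel X -> borel X)
  (isMeasurableFun.Build _ _ _ _ _ (mf j)).
exists (msum (fun i => mscale (NngNum (w0 (inord i)))
  (distribution nu (F (inord i)))) n.+1) => [|h mh h0].
  by apply/funext => A; apply: eq_bigr => j _; rewrite /= /mscale/= inord_val.
have mhE : measurable_fun [set: borel X] (EFin \o h) by exact/measurable_EFinP.
rewrite ge0_integral_measure_sum//; last by move=> x _; rewrite lee_fin.
under [RHS]eq_integral => x _ do rewrite /transfer -sumEFin.
rewrite ge0_integral_sum//.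
- apply: eq_bigr => j _; rewrite /= ge0_integral_mscale//=; last first.
    by move=> x _; rewrite lee_fin.
  rewrite (ge0_integral_pushforward (mf _))//=; last first.
    by move=> x _; rewrite lee_fin.
  rewrite inord_val preimage_setT -ge0_integralZl//.
  + by apply/measurable_EFinP; exact: (measurableT_comp mh (mf j)).
  + by move=> x _; rewrite lee_fin.
  + by rewrite lee_fin.
- move=> j; apply/measurable_EFinP; apply: measurable_funM => //.
  exact: (measurableT_comp mh (mf j)).
- by move=> j x _; rewrite lee_fin mulr_ge0.
Qed.

Lemma integral_Pstar nu (h : borel X -> R) :
  measurable_fun setT h -> (forall x, 0 <= h x) ->
  (\int[Pstar f w nu]_x (h x)%:E = \int[nu]_x (transfer f w h x)%:E)%E.
Proof. by have [p -> pE] := Pstar_measure nu; exact: pE. Qed.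

Lemma Rintegral_transfer nu nu' (h : borel X -> R) :
  measurable_fun setT h -> (forall x, 0 <= h x) ->
  (forall A, measurable A -> nu' A = Pstar f w nu A) ->
  mean nu' h = mean nu (transfer f w h).
Proof.
move=> mh h0 nu'E; congr fine; have [p pE <-//] := Pstar_measure nu.
by apply: eq_measure_integral => A mA _; move: (nu'E A mA); rewrite pE.
Qed.

Lemma Pstar_integrable nu M (h : borel X -> R) :
  measurable_fun setT h -> between M h ->
  (Pstar f w nu).-integrable setT (EFin \o h).
Proof.
move=> mh hM; apply/integrableP; split; first exact/measurable_EFinP.
have -> : (fun x : borel X => `|(EFin \o h) x|)%E = EFin \o h.
  by apply/funext => x /=; rewrite ger0_norm//; case/andP: (hM x).
rewrite integral_Pstar//; last by move=> x; case/andP: (hM x).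
have := between_integrable nu (transfer_measurable mh) (transfer_between hM).
by move=> /integrable_lty; exact.
Qed.

(** For [g] with Hoelder constant 1, the contraction applied to the Dirac masses
    at [x] and [y] bounds [transfer f w g x - transfer f w g y], which is the
    difference of the integrals of [g] against their images. *)
Lemma transfer_scaled_holder alpha r c M (h : X -> R) :
  0 < alpha -> 0 < c -> 0 < r ->
  (forall x y : X,
    (wasserstein alpha (Pstar f w \d_(x : borel X)) (Pstar f w \d_(y : borel X))
      <= r%:E * wasserstein alpha \d_(x : borel X) \d_(y : borel X))%E) ->
  between M h -> scaled_holder alpha c h ->
  scaled_holder alpha (r * c) (transfer f w h).
Proof.
move=> a0 c0 r0 contr hM hH.
suff H x y : transfer f w h x - transfer f w h y <= r * c * mdist x y `^ alpha.
  by move=> x y; rewrite ler_norml H andbT lerNl opprB metric_sym.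
pose g x := c^-1 * h x.
have gH : holder_class alpha g.
  move=> a b; rewrite /g -mulrBr normrM gtr0_norm ?invr_gt0//.
  by rewrite ler_pdivrMl.
have gM : between (c^-1 * M) g.
  move=> a; have /andP[h0 h1] := hM a.
  by rewrite /g mulr_ge0 ?invr_ge0 ?(ltW c0)//= ler_pM2l ?invr_gt0.
have g0 a : 0 <= g a by case/andP: (gM a).
have mg := scaled_holder_measurable a0 (holder_class_scaled gH).
have tg a : transfer f w h a = c * transfer f w g a.
  rewrite /transfer mulr_sumr; apply: eq_bigr => j _.
  by rewrite /g mulrCA mulVKf// gt_eqF.
rewrite !tg -mulrBr mulrAC mulrC ler_pM2r// -lee_fin.
apply: (@le_trans _ _
  (r%:E * wasserstein alpha \d_(x : borel X) \d_(y : borel X))%E); last first.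
  by rewrite EFinM lee_pmul2l// ?lte_fin//; exact: wasserstein_dirac_le.
apply: (le_trans _ (contr x y)); apply: ereal_sup_ubound; exists g.
  by split => //; exact: Pstar_integrable gM.
rewrite !integral_Pstar// !integral_dirac//;
  try by apply/measurable_EFinP; exact: transfer_measurable.
by rewrite !diracT !mul1e -EFinB.
Qed.

(** * Distance to an invariant law *)

Lemma wasserstein_invariant_le alpha r nu0 nu1 (nustar : probability (borel X) R) :
  0 < alpha -> 0 < r -> r < 1 ->
  (forall nu nu' : probability (borel X) R,
    (wasserstein alpha (Pstar f w nu) (Pstar f w nu')
      <= r%:E * wasserstein alpha nu nu')%E) ->
  (forall A, measurable A -> Pstar f w nustar A = nustar A) ->
  (forall A, measurable A -> nu1 A = Pstar f w nu0 A) ->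
  (wasserstein alpha nu1 nustar
     <= (r / (1 - r))%:E * wasserstein alpha nu1 nu0)%E.
Proof.
move=> a0 r0 r1 contr nustar_inv nu1E.
have := wasserstein_ge0 alpha nu1 nu0.
case wE : (wasserstein alpha nu1 nu0) => [D| |] // D0; last first.
  by rewrite gt0_muley ?leey// lte_fin divr_gt0// subr_gt0.
rewrite lee_fin in D0.
rewrite -EFinM; apply: wasserstein_le_between => // g M gH gM.
pose h n := iter n (transfer f w) g.
have hM n : between M (h n) by elim: n => // n ih; exact: transfer_between.
have h0 n x : 0 <= h n x by case/andP: (hM n x).
have hH n : scaled_holder alpha (r ^+ n) (h n).
  elim: n => [|n ih]; first exact: holder_class_scaled.
  rewrite exprS; apply: transfer_scaled_holder (hM n) ih => //.
    by rewrite exprn_gt0.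
  by move=> x y; exact: contr.
have mh n := scaled_holder_measurable a0 (hH n).
pose E0 n := mean nu0 (h n).
pose E1 n := mean nu1 (h n).
pose Es n := mean nustar (h n).
have E1S n : E1 n = E0 n.+1 by apply: (Rintegral_transfer (mh n)).
have EsE n : Es 0%N = Es n.
  elim: n => // n ->; apply: (Rintegral_transfer (mh n)) => // A mA.
  by rewrite nustar_inv.
have step n : E1 n - E1 n.+1 <= r ^+ n.+1 * D.
  rewrite E1S; apply: (scaled_holder_gap a0 _ (hM _) (hH _)) => //.
    by rewrite exprn_gt0.
  by rewrite wE.
have bound n : E1 0%N - E1 n <= r / (1 - r) * D.
  apply: (@le_trans _ _ (series (geometric r r) n * D)); last first.
    by rewrite ler_wpM2r// geometric_le_lim ?ltW// gtr0_norm.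
  elim: n => [|n ih]; first by rewrite subrr /series/= big_geq// mul0r.
  rewrite seriesSr/= mulrDl -exprS.
  by have := step n; lra.
have remainder : E1 n - Es n @[n --> \oo] --> 0.
  have -> : (fun n => E1 n - Es n) =
      (fun n => (E1 n - h n point) - (Es n - h n point)).
    by apply/funext => n; ring.
  rewrite -[X in _ --> X]subr0.
  by apply: cvgB; exact: Rintegral_flattening hM hH.
have gap : (E1 0%N - Es 0%N) - (E1 n - Es n) @[n --> \oo] --> (E1 0%N - Es 0%N).
  by rewrite -[X in _ --> X]subr0; apply: cvgB => //; exact: cvg_cst.
apply: (cvgr_to_le gap); apply: nearW => n.
by have := bound n; rewrite -(EsE n); lra.
Qed.

End transfer.

Theorem theorem5p7 (R : realType) (X : completeMetricType R)
  (sepX : separable X)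
  (m : nat) (f : 'I_m -> X -> X)
  (f_lip : forall j : 'I_m, lipschitz_map (f j))
  (mu : nat -> 'I_m -> R)
  (mu_prob : forall k : nat, probability_weights (mu k))
  (e : R) (e_ge0 : 0 <= e)
  (mu_var : forall k : nat, (0 < k)%N ->
     \sum_(j < m) `|mu k j - mu k.+1 j| <= e)
  (alpha : R) (alpha_gt0 : 0 < alpha) (alpha_le1 : alpha <= 1)
  (r : R) (r_gt0 : 0 < r) (r_lt1 : r < 1)
  (contr : forall (k : nat) (nu1 nu2 : probability (borel X) R),
     (wasserstein alpha (Pstar f (mu k) nu1) (Pstar f (mu k) nu2)
        <= r%:E * wasserstein alpha nu1 nu2)%E)
  (nustar : nat -> probability (borel X) R)
  (nustar_inv : forall (k : nat) (A : set (borel X)), measurable A ->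
     Pstar f (mu k) (nustar k) A = nustar k A)
  (nu : nat -> nat -> probability (borel X) R)
  (nu_step : forall (k i : nat) (A : set (borel X)), measurable A ->
     nu k i.+1 A = Pstar f (mu k) (nu k i) A) :
  forall k : nat,
    (wasserstein alpha (nu k 1%N) (nustar k)
       <= (r / (1 - r) ^+ 2)%:E * wasserstein alpha (nu k 1%N) (nu k 0%N))%E.
Proof.
move=> k.
apply: (le_trans (wasserstein_invariant_le f_lip (mu_prob k) alpha_gt0 r_gt0
  r_lt1 (contr k) (nustar_inv k) (nu_step k 0%N))).
apply: lee_wpmul2r; first exact: wasserstein_ge0.
rewrite lee_fin ler_pM2l// lef_pV2 ?posrE ?exprn_gt0 ?subr_gt0//.
by rewrite expr2 ler_piMl; lra.
Qed.
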